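(* Let $n\ge1$ and let $A$ be a real $n\times n$ matrix with $\operatorname{rank}(A)=1$. Then $\operatorname{dih}(A)=0$.
   Context: For $n\ge1$ and $k=1,\dots,n$, let $\rho_k$ be the permutation of $\{1,\dots,n\}$ with $\rho_k(1)=k,\rho_k(2)=k+1,\dots,\rho_k(n-k+1)=n,\rho_k(n-k+2)=1,\dots,\rho_k(n)=k-1$, and let $\mu_k$ be the permutation with $\mu_k(1)=k,\mu_k(2)=k-1,\dots,\mu_k(k)=1,\mu_k(k+1)=n,\mu_k(k+2)=n-1,\dots,\mu_k(n)=k+1$. For an $n\times n$ matrix $A=(a_{i,j})$, the dihedrant is $$\operatorname{dih}(A)=\sum_{k=1}^n\prod_{i=1}^n a_{i,\rho_k(i)}-\sum_{k=1}^n\prod_{i=1}^n a_{i,\mu_k(i)}.$$ *)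

(* Defs.v *)
From HB Require Import structures.
From mathcomp Require Import all_boot all_order all_fingroup all_algebra.
From mathcomp Require Import zify.
From mathcomp Require Import reals.

Set Implicit Arguments.
Unset Strict Implicit.
Unset Printing Implicit Defensive.

Import GRing.Theory.
Local Open Scope ring_scope.

(* Rows, columns and the parameter k are all numbered from 0: the index k : 'I_n
   stands for k + 1 in {1, ..., n}, and likewise for positions and values. *)

(* One-based: i |-> k + i - 1 for i <= n - k + 1, and i |-> k + i - 1 - n
   afterwards. *)
Definition rho_nat (n k i : nat) : nat :=
  (if i + k < n then i + k else i + k - n)%N.

(* One-based: i |-> k + 1 - i for i <= k, and i |-> n + k + 1 - i afterwards. *)
Definition mu_nat (n k i : nat) : nat :=
  (if i <= k then k - i else n + k - i)%N.

Lemma rho_nat_lt (n : nat) (k i : 'I_n) : (rho_nat n k i < n)%N.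
Proof. by rewrite /rho_nat; case: k i => k hk [i hi] /=; case: ifP; lia. Qed.

Lemma mu_nat_lt (n : nat) (k i : 'I_n) : (mu_nat n k i < n)%N.
Proof. by rewrite /mu_nat; case: k i => k hk [i hi] /=; case: ifP; lia. Qed.

Definition rho_fun (n : nat) (k i : 'I_n) : 'I_n := Ordinal (rho_nat_lt k i).
Definition mu_fun (n : nat) (k i : 'I_n) : 'I_n := Ordinal (mu_nat_lt k i).

Lemma rho_fun_inj (n : nat) (k : 'I_n) : injective (rho_fun k).
Proof.
move=> [i hi] [j hj] /(congr1 val); rewrite /= /rho_nat => e.
by apply: val_inj => /=; move: e; case: k => k hk /=; do 2![case: ifP]; lia.
Qed.

Lemma mu_fun_inj (n : nat) (k : 'I_n) : injective (mu_fun k).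
Proof.
move=> [i hi] [j hj] /(congr1 val); rewrite /= /mu_nat => e.
by apply: val_inj => /=; move: e; case: k => k hk /=; do 2![case: ifP]; lia.
Qed.

Definition rho (n : nat) (k : 'I_n) : 'S_n := perm (@rho_fun_inj n k).
Definition mu (n : nat) (k : 'I_n) : 'S_n := perm (@mu_fun_inj n k).

Definition dih (R : comNzRingType) (n : nat) (A : 'M[R]_n) : R :=
  \sum_(k < n) \prod_(i < n) A i (rho k i)
  - \sum_(k < n) \prod_(i < n) A i (mu k i).

(* Main.v *)
Require Import Defs.
From mathcomp Require Import all_boot all_order all_fingroup all_algebra.
From mathcomp Require Import reals.

Import GRing.Theory.
Local Open Scope ring_scope.

(** A matrix of rank one is an outer product [u v], so the product of its
    entries along any permutation is [\prod_i u_i * \prod_j v_j]. The dihedrant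
    is therefore the difference of two sums of [n] copies of this product. *)

Lemma mxrank1_outer (F : fieldType) (m n : nat) (A : 'M[F]_(m, n)) :
  \rank A = 1%N -> exists (u : 'cV[F]_m) (v : 'rV[F]_n), A = u *m v.
Proof.
(* The types of both factors in the rank factorization depend on [\rank A], so they are generalized
   before [rA] turns the inner dimension into 1. *)
move=> rA; move: (col_base A) (row_base A) (mulmx_base A).
by rewrite rA => u v <-; exists u, v.
Qed.

Lemma prod_perm_outer (R : comNzRingType) (n : nat) (u : 'cV[R]_n)
    (v : 'rV[R]_n) (s : 'S_n) :
  \prod_(i < n) (u *m v) i (s i) = \prod_(i < n) u i 0 * \prod_(j < n) v 0 j.
Proof.
(* Reindexing the product over columns by [s] pairs [v 0 (s i)] with [u i 0]. *)
rewrite [X in _ * X](reindex_perm s) -big_split /=.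
by apply: eq_bigr => i _; rewrite mxE big_ord1.
Qed.

Lemma dih_outer (R : comNzRingType) (n : nat) (u : 'cV[R]_n) (v : 'rV[R]_n) :
  dih (u *m v) = 0.
Proof.
(* The two sums agree term by term: the products along [rho k] and [mu k] have the same value. *)
by apply/eqP; rewrite subr_eq0; apply/eqP/eq_bigr => k _; rewrite !prod_perm_outer.
Qed.

Theorem theorem4 (R : realType) (n : nat) (hn : (1 <= n)%N) (A : 'M[R]_n)
    (hA : \rank A = 1%N) : dih A = 0.
Proof. by have [u [v ->]] := mxrank1_outer _ _ _ _ hA; exact: dih_outer. Qed.
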